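(* Suppose the weights are $w_i=z_i\|\phi_i\|_{L^\infty}$, where $z_i\ge1$ and $z_i\to\infty$ as $i\to\infty$. For $0<\epsilon<1/2$, let the point set (with density $h>0$) and $M,R\in\mathbb N$ be such that $$E(h,M)<\epsilon,\qquad E(h,R)<\epsilon\frac{\min_{M<i\le R}\{w_i\}}{\max_{i=1,\dots,M}\{w_i\}},\qquad F(h,M,R)\le\frac{\epsilon}{\max_{i=1,\dots,M}\{w_i\}}.$$ Then there exists a constant $C(\epsilon)$ such that, whenever $\hat x$ is a minimizer of $\min_{z\in\mathbb C^K}\|z\|_{1,w}$ subject to $\|UP_Kz-y\|\le\eta$, $$\|x-\hat x\|\le C(\epsilon)\left[(1+\|P_Mw\|)\eta+\|P_M^\perp x\|_{1,w}+T_{h,K,\eta}(x)\right].$$ Moreover, $\lim_{\epsilon\to0^+}C(\epsilon)=4$.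
   Context: Setting: $D\subseteq\mathbb R^d$ a domain, $\nu\ge0$ integrable on $D$ with $\int_D\nu=1$, $\{\phi_i\}_{i\in\mathbb N}\subseteq L^2_\nu(D)\cap L^\infty(D)$ orthonormal in $L^2_\nu(D)$. $T=\{t_n\}_{n=1}^N\subseteq\overline D$ with density $h=\sup_{t\in D}\min_n|t-t_n|$, Voronoi cells $V_n=\{t\in D:|t-t_n|\le|t-t_m|\ \forall m\ne n\}$ and quadrature weights $\tau_n=\int_{V_n}\nu$. $W=\mathrm{diag}(w_1,w_2,\dots)$, $\|z\|_{1,w}=\sum_iw_i|z_i|$. $U$ is the $N\times\infty$ matrix $U_{n,i}=\sqrt{\tau_n}\phi_i(t_n)$. The target is $f=\sum_ix_i\phi_i$ with $x\in\ell^1_w(\mathbb N)$; data $y=\{\sqrt{\tau_n}(f(t_n)+e_n)\}_{n=1}^N$, $|e_n|\le\eta$. $P_M$ is the projection onto the first $M$ coordinates, $P_M^\perp=I-P_M$; $\mathbb C^K$ is identified with sequences supported in $\{1,\dots,K\}$; $P_Mw=(w_1,\dots,w_M)$ and $\|\cdot\|$ is the $\ell^2$ norm. $E_2(h,M)=\|P_M-P_MU^*UP_M\|$ ($\ell^2$ operator norm), $E_\infty(h,M)=\|P_M-P_MU^*UP_M\|_\infty$ ($\ell^\infty$ operator norm), $E(h,M)=\max\{E_2,E_\infty\}$, $F(h,M,R)=\|P_R^\perp W^{-1}U^*UP_M\|_\infty$. Finally $T_{h,K,\eta}(x)=\inf\{\|x-\bar x\|_{1,w}:\bar x\in\mathbb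 C^K,\ \|UP_K\bar x-y\|\le\eta\}$. *)

(* Defs.v *)
(* Conventions.
   Indices are 0-based: coordinate i (Rocq) = coordinate i+1 (paper). *)
From HB Require Import structures.
From mathcomp Require Import all_boot all_order all_algebra.
From mathcomp Require Import all_classical all_reals all_analysis.
From mathcomp Require Import complex.
Set Implicit Arguments.
Unset Strict Implicit.
Unset Printing Implicit Defensive.
Import Order.TTheory GRing.Theory Num.Theory.
Import numFieldNormedType.Exports.
Local Open Scope classical_set_scope.
Local Open Scope ring_scope.

(** Measurable structure on row vectors 'rV[T]_n: the sigma-algebra generated
    by the coordinate projections (for T = R this is the Borel sigma-algebra
    of R^n), exactly as mathcomp-analysis does for n.-tuple T. *)
Definition measure_rV_display : measure_display -> measure_display.
Proof. exact. Qed.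

Section measurable_rV.
Context {d} {T : sigmaRingType d}.
Variable n : nat.
Let coors : 'I_n -> 'rV[T]_n -> T := fun i x => x ord0 i.
Let rV_set0 : g_sigma_preimage coors set0.
Proof. exact: sigma_algebra0. Qed.
Let rV_setC A : g_sigma_preimage coors A -> g_sigma_preimage coors (~` A).
Proof. exact: sigma_algebraC. Qed.
Let rV_bigcup (F : _^nat) : (forall i, g_sigma_preimage coors (F i)) ->
  g_sigma_preimage coors (\bigcup_i (F i)).
Proof. exact: sigma_algebra_bigcup. Qed.
HB.instance Definition _ := @isMeasurable.Build (measure_rV_display d)
  'rV[T]_n (g_sigma_preimage coors) rV_set0 rV_setC rV_bigcup.
End measurable_rV.

Section Defs.
Context {R : realType}.
Local Notation C := R[i].

Definition cabs (z : C) : R := Num.sqrt (complex.Re z ^+ 2 + complex.Im z ^+ 2).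
Definition cconj (z : C) : C := Complex (complex.Re z) (- complex.Im z).

Definition esqrt (x : \bar R) : \bar R :=
  match x with EFin r => (Num.sqrt r)%:E | +oo%E => +oo%E | -oo%E => 0%E end.

Definition edist {d : nat} (s t : 'rV[R]_d) : R :=
  Num.sqrt (\sum_(j < d) (s ord0 j - t ord0 j) ^+ 2).

Definition box {d : nat} (a b : 'rV[R]_d) : set 'rV[R]_d :=
  [set t | forall j, a ord0 j <= t ord0 j <= b ord0 j].

Definition is_lebesgue {d : nat} (lam : {measure set 'rV[R]_d -> \bar R}) : Prop :=
  forall a b : 'rV[R]_d, (forall j, a ord0 j <= b ord0 j) ->
    lam (box a b) = (\prod_(j < d) (b ord0 j - a ord0 j))%:E.

Definition is_domain {d : nat} (D : set 'rV[R]_d) : Prop :=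
  open D /\ connected D /\ D !=set0.

Definition in_L2nu {d : nat} (lam : {measure set 'rV[R]_d -> \bar R})
  (D : set 'rV[R]_d) (nu : 'rV[R]_d -> R) (g : 'rV[R]_d -> C) : Prop :=
  measurable_fun D (fun t => complex.Re (g t)) /\ measurable_fun D (fun t => complex.Im (g t)) /\
  (\int[lam]_(t in D) (cabs (g t) ^+ 2 * nu t)%:E < +oo)%E.

(** g in L^oo: bounded (on the closure of D, where it is evaluated) *)
Definition in_Linf {d : nat} (D : set 'rV[R]_d) (g : 'rV[R]_d -> C) : Prop :=
  exists B : R, forall t, closure D t -> cabs (g t) <= B.

Definition supnorm {d : nat} (D : set 'rV[R]_d) (g : 'rV[R]_d -> C) : R :=
  sup [set cabs (g t) | t in closure D].

Definition orthonormal_nu {d : nat} (lam : {measure set 'rV[R]_d -> \bar R})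
  (D : set 'rV[R]_d) (nu : 'rV[R]_d -> R) (phi : nat -> 'rV[R]_d -> C) : Prop :=
  forall i j,
    (\int[lam]_(t in D) (complex.Re (phi i t * cconj (phi j t)) * nu t)%:E
       = (if i == j then 1 else 0)%:E)%E /\
    (\int[lam]_(t in D) (complex.Im (phi i t * cconj (phi j t)) * nu t)%:E = 0%:E)%E.

Definition density {d N : nat} (D : set 'rV[R]_d) (tp : 'I_N -> 'rV[R]_d) : \bar R :=
  ereal_sup [set (\big[Order.min/+oo%E]_(n < N) (edist t (tp n))%:E)%E | t in D].

Definition voronoi {d N : nat} (D : set 'rV[R]_d) (tp : 'I_N -> 'rV[R]_d)
  (n : 'I_N) : set 'rV[R]_d :=
  [set t | D t /\ forall m : 'I_N, m != n -> edist t (tp n) <= edist t (tp m)].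

Definition qweight {d N : nat} (lam : {measure set 'rV[R]_d -> \bar R})
  (D : set 'rV[R]_d) (nu : 'rV[R]_d -> R) (tp : 'I_N -> 'rV[R]_d) (n : 'I_N) : R :=
  fine (\int[lam]_(t in voronoi D tp n) (nu t)%:E)%E.

Definition Umat {d N : nat} (tau : 'I_N -> R) (phi : nat -> 'rV[R]_d -> C)
  (tp : 'I_N -> 'rV[R]_d) (n : 'I_N) (i : nat) : C :=
  ((Num.sqrt (tau n))%:C)%C * phi i (tp n).

Definition gram {N : nat} (U : 'I_N -> nat -> C) (i j : nat) : C :=
  \sum_(n < N) cconj (U n i) * U n j.

Definition wnorm1 (w : nat -> R) (v : nat -> C) : \bar R :=
  (\sum_(i <oo) (w i * cabs (v i))%:E)%E.
Definition tail_wnorm1 (M : nat) (w : nat -> R) (v : nat -> C) : \bar R :=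
  (\sum_(M <= i <oo) (w i * cabs (v i))%:E)%E.
Definition l2norm (v : nat -> C) : \bar R :=
  esqrt (\sum_(i <oo) (cabs (v i) ^+ 2)%:E)%E.
Definition linfnorm (v : nat -> C) : \bar R :=
  ereal_sup [set (cabs (v i))%:E | i in [set: nat]].

(** sequences supported in the first K coordinates (= C^K) *)
Definition supported (K : nat) (v : nat -> C) : Prop :=
  forall i, (K <= i)%N -> v i = 0.

(** application of an infinite matrix A whose columns j >= M vanish
    (i.e. A = A P_M) to a sequence v *)
Definition applyM (M : nat) (A : nat -> nat -> C) (v : nat -> C) : nat -> C :=
  fun i => \sum_(j < M) A i j * v j.

(** the matrix P_M - P_M U^*U P_M *)
Definition IminusG {N : nat} (U : 'I_N -> nat -> C) (M : nat) : nat -> nat -> C :=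
  fun i j => if (i < M)%N then ((i == j)%:R - gram U i j) else 0.

Definition E2 {N : nat} (U : 'I_N -> nat -> C) (M : nat) : \bar R :=
  ereal_sup [set l2norm (applyM M (IminusG U M) v) | v in [set v | (l2norm v <= 1)%E]].
Definition Einf {N : nat} (U : 'I_N -> nat -> C) (M : nat) : \bar R :=
  ereal_sup [set linfnorm (applyM M (IminusG U M) v) | v in [set v | (linfnorm v <= 1)%E]].
Definition Eerr {N : nat} (U : 'I_N -> nat -> C) (M : nat) : \bar R :=
  Order.max (E2 U M) (Einf U M).

(** F = || P_R^perp W^{-1} U^*U P_M ||_oo *)
Definition Ferr {N : nat} (U : 'I_N -> nat -> C) (w : nat -> R) (M Rr : nat) : \bar R :=
  ereal_sup [set linfnorm (applyM M
      (fun i j => if (Rr <= i)%N then (((w i)^-1)%:C)%C * gram U i j else 0) v)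
    | v in [set v | (linfnorm v <= 1)%E]].

Definition fval {d : nat} (phi : nat -> 'rV[R]_d -> C) (x : nat -> C) (t : 'rV[R]_d) : C :=
  Complex (limn (fun k => \sum_(i < k) complex.Re (x i * phi i t)))
          (limn (fun k => \sum_(i < k) complex.Im (x i * phi i t))).

Definition datay {d N : nat} (tau : 'I_N -> R) (phi : nat -> 'rV[R]_d -> C)
  (tp : 'I_N -> 'rV[R]_d) (x : nat -> C) (e : 'I_N -> C) (n : 'I_N) : C :=
  ((Num.sqrt (tau n))%:C)%C * (fval phi x (tp n) + e n).

Definition resid {N : nat} (U : 'I_N -> nat -> C) (K : nat) (z : nat -> C)
  (y : 'I_N -> C) : R :=
  Num.sqrt (\sum_(n < N) cabs (\sum_(i < K) U n i * z i - y n) ^+ 2).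

Definition feasible {N : nat} (U : 'I_N -> nat -> C) (K : nat) (y : 'I_N -> C)
  (eta : R) (z : nat -> C) : Prop :=
  supported K z /\ resid U K z y <= eta.

Definition is_minimizer {N : nat} (w : nat -> R) (U : 'I_N -> nat -> C) (K : nat)
  (y : 'I_N -> C) (eta : R) (xh : nat -> C) : Prop :=
  feasible U K y eta xh /\
  forall z, feasible U K y eta z -> (wnorm1 w xh <= wnorm1 w z)%E.

Definition Tbest {N : nat} (w : nat -> R) (U : 'I_N -> nat -> C) (K : nat)
  (y : 'I_N -> C) (eta : R) (x : nat -> C) : \bar R :=
  ereal_inf [set wnorm1 w (fun i => x i - xb i) | xb in feasible U K y eta].

End Defs.

(* Main.v *)
Require Import Defs.
From HB Require Import structures.
From mathcomp Require Import all_boot all_order all_algebra.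
From mathcomp Require Import all_classical all_reals all_analysis.
From mathcomp Require Import complex.
From mathcomp Require Import ring lra measurable_realfun.
Import Order.TTheory GRing.Theory Num.Theory.
Import numFieldNormedType.Exports.
Local Open Scope classical_set_scope.
Local Open Scope ring_scope.

(* Put G = P_M U^*U P_M and compare the minimizer xh with a feasible xb through
   v = xh - xb, so that |Uv| <= 2 eta and the noise itself never enters.
   Minimality gives the cone condition
   |P_M^perp v|_{1,w} <= 2 |P_M^perp xb|_{1,w} + |<s, P_M v>| with s_i = w_i sgn(xb_i).
   The bound on the l^oo norm of I - G controls, by the Schur test, its l^2 norm
   as well, so G is invertible with inverse at most 1/(1 - eps) in both norms.
   Writing s = G g and G P_M v = P_M U^*U v - P_M U^*U P_M^perp v, the pairing is at most
   |g|_2 |P_M U^*U v|_2 + |g|_oo |P_M U^*U P_M^perp v|_1; the last factor is at most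
   eps / max_{i<M} w_i times |P_M^perp v|_{1,w} because of the hypotheses on E(h,R)
   and F(h,M,R).  Absorbing that term needs eps/(1 - eps) < 1, i.e. eps < 1/2.
   Finally l^2 is dominated by l^1_w since orthonormality and int nu = 1 force
   w_i >= sup |phi_i| >= 1. *)

(** * Modulus and conjugation of complex numbers *)

(** Ties the real-valued modulus to the norm of [R[i]], whose laws then descend through the
    injective embedding of the reals. *)
Lemma cabsE {R : realType} (z : R[i]) : (cabs z)%:C%C = `|z|.
Proof. by rewrite normc_def. Qed.

Lemma cabs_ge0 {R : realType} (z : R[i]) : 0 <= cabs z.
Proof. exact: sqrtr_ge0. Qed.

Lemma cabs0 {R : realType} : cabs (0 : R[i]) = 0.
Proof. by apply: complexI; rewrite cabsE normr0. Qed.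

Lemma cabs_eq0 {R : realType} (z : R[i]) : (cabs z == 0) = (z == 0).
Proof. by rewrite -[RHS]normr_eq0 -cabsE fmorph_eq0. Qed.

Lemma cabsM {R : realType} (y z : R[i]) : cabs (y * z) = cabs y * cabs z.
Proof. by apply: complexI; rewrite rmorphM /= !cabsE normrM. Qed.

Lemma cabsN {R : realType} (z : R[i]) : cabs (- z) = cabs z.
Proof. by apply: complexI; rewrite !cabsE normrN. Qed.

Lemma cabs_real {R : realType} (a : R) : cabs a%:C%C = `|a|.
Proof. by rewrite /cabs /= expr0n /= addr0 sqrtr_sqr. Qed.

Lemma cconjE {R : realType} (z : R[i]) : cconj z = (z^*)%C.
Proof. by case: z. Qed.

Lemma cconjM {R : realType} (y z : R[i]) : cconj (y * z) = cconj y * cconj z.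
Proof. by rewrite !cconjE rmorphM. Qed.

Lemma cconj_real {R : realType} (a : R) : cconj a%:C%C = a%:C%C.
Proof. by rewrite cconjE conjc_real. Qed.

Lemma cconjK {R : realType} : involutive (@cconj R).
Proof. by move=> z; rewrite !cconjE conjcK. Qed.

Lemma cabs_conj {R : realType} (z : R[i]) : cabs (cconj z) = cabs z.
Proof. by rewrite /cabs /= sqrrN. Qed.

Lemma mul_conj {R : realType} (z : R[i]) : cconj z * z = ((cabs z) ^+ 2)%:C%C.
Proof.
case: z => a b; rewrite /cabs sqr_sqrtr ?addr_ge0 ?sqr_ge0//=.
by apply/eqP; rewrite eq_complex /=; apply/andP; split; apply/eqP; ring.
Qed.

Lemma ler_cabsD {R : realType} (y z : R[i]) : cabs (y + z) <= cabs y + cabs z.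
Proof. by rewrite -lecR rmorphD /= !cabsE ler_normD. Qed.

Lemma ler_cabs_sum {R : realType} {I : Type} (r : seq I) (P : pred I) (f : I -> R[i]) :
  cabs (\sum_(i <- r | P i) f i) <= \sum_(i <- r | P i) cabs (f i).
Proof.
elim/big_ind2: _ => //; first by rewrite cabs0.
by move=> ? ? ? ? h1 h2; rewrite (le_trans (ler_cabsD _ _)) ?lerD.
Qed.

Lemma ler_Re_cabs {R : realType} (z : R[i]) : complex.Re z <= cabs z.
Proof.
rewrite /cabs (le_trans (ler_norm _))// -sqrtr_sqr ler_wsqrtr// lerDl.
exact: sqr_ge0.
Qed.

Lemma Re_sum {R : realType} {I : Type} (r : seq I) (P : pred I) (f : I -> R[i]) :
  complex.Re (\sum_(i <- r | P i) f i) = \sum_(i <- r | P i) complex.Re (f i).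
Proof. by apply: (big_morph (@complex.Re R)) => [[? ?] [? ?]|]. Qed.

Lemma conj_sum {R : realType} {I : Type} (r : seq I) (P : pred I) (f : I -> R[i]) :
  cconj (\sum_(i <- r | P i) f i) = \sum_(i <- r | P i) cconj (f i).
Proof. by rewrite cconjE rmorph_sum; apply: eq_bigr => i _; rewrite cconjE. Qed.

(** * Finite l^2 norms *)

(** An arbitrary index sequence serves both coefficient vectors ([index_iota]) and sample vectors
    ([index_enum 'I_N]). *)
Definition nrm2 {R : realType} {I : Type} (r : seq I) (f : I -> R[i]) : R :=
  Num.sqrt (\sum_(i <- r) cabs (f i) ^+ 2).

Lemma nrm2_ge0 {R : realType} {I : Type} (r : seq I) (f : I -> R[i]) : 0 <= nrm2 r f.
Proof. exact: sqrtr_ge0. Qed.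

Lemma sqr_nrm2 {R : realType} {I : Type} (r : seq I) (f : I -> R[i]) :
  nrm2 r f ^+ 2 = \sum_(i <- r) cabs (f i) ^+ 2.
Proof. by rewrite sqr_sqrtr// sumr_ge0// => i _; rewrite sqr_ge0. Qed.


Lemma cauchy_schwarz2 {R : realType} (a b p q : R) :
  a * b + p * q <= Num.sqrt (a ^+ 2 + p ^+ 2) * Num.sqrt (b ^+ 2 + q ^+ 2).
Proof.
rewrite -sqrtrM ?addr_ge0 ?sqr_ge0//.
rewrite (le_trans (ler_norm _))// -sqrtr_sqr ler_wsqrtr//.
(* Lagrange's identity: the gap between the two squares is (aq - bp)^2. *)
by have := sqr_ge0 (a * q - b * p); nra.
Qed.

Lemma cauchy_schwarz_sum {R : realType} {I : Type} (r : seq I) (a b : I -> R) :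
  \sum_(i <- r) a i * b i <=
  Num.sqrt (\sum_(i <- r) a i ^+ 2) * Num.sqrt (\sum_(i <- r) b i ^+ 2).
Proof.
elim: r => [|k r ih]; first by rewrite !big_nil sqrtr0 mulr0.
rewrite !big_cons (le_trans (lerD (lexx _) ih))//.
rewrite (le_trans (cauchy_schwarz2 _ _ _ _))//.
by rewrite !sqr_sqrtr ?sumr_ge0// => i _; rewrite sqr_ge0.
Qed.

Lemma cauchy_schwarz_cabs {R : realType} {I : Type} (r : seq I) (f g : I -> R[i]) :
  cabs (\sum_(i <- r) f i * g i) <= nrm2 r f * nrm2 r g.
Proof.
rewrite (le_trans (ler_cabs_sum _ _ _))// (le_trans _ (cauchy_schwarz_sum _ _ _))//.
by rewrite ler_sum// => i _; rewrite cabsM.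
Qed.

Lemma ler_nrm2D {R : realType} {I : Type} (r : seq I) (f g : I -> R[i]) :
  nrm2 r (fun i => f i + g i) <= nrm2 r f + nrm2 r g.
Proof.
rewrite -ler_sqr ?nnegrE ?addr_ge0 ?nrm2_ge0//.
have -> : (nrm2 r f + nrm2 r g) ^+ 2 =
   nrm2 r f ^+ 2 + nrm2 r g ^+ 2 + 2 * (nrm2 r f * nrm2 r g) by ring.
rewrite !sqr_nrm2.
apply: le_trans (lerD (lexx _) (ler_wpM2l _ (cauchy_schwarz_sum r _ _))) => //.
rewrite mulr_sumr -!big_split /= ler_sum// => i _.
have -> : cabs (f i) ^+ 2 + cabs (g i) ^+ 2 + 2 * (cabs (f i) * cabs (g i)) =
  (cabs (f i) + cabs (g i)) ^+ 2 by ring.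
by rewrite ler_sqr ?nnegrE ?addr_ge0 ?cabs_ge0 ?ler_cabsD.
Qed.

Lemma nrm2_le_sum {R : realType} {I : Type} (r : seq I) (f : I -> R[i]) :
  nrm2 r f <= \sum_(i <- r) cabs (f i).
Proof.
have h0 : 0 <= \sum_(i <- r) cabs (f i) by rewrite sumr_ge0// => i _; rewrite cabs_ge0.
rewrite -ler_sqr ?nnegrE ?nrm2_ge0// sqr_nrm2 {h0}.
elim: r => [|k r ih]; first by rewrite !big_nil expr0n.
rewrite !big_cons (le_trans (lerD (lexx _) ih))//.
have h0 : 0 <= \sum_(i <- r) cabs (f i) by rewrite sumr_ge0// => i _; rewrite cabs_ge0.
by have := cabs_ge0 (f k); nra.
Qed.

Lemma nrm2_cat {R : realType} {I : Type} (r s : seq I) (f : I -> R[i]) :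
  nrm2 (r ++ s) f <= nrm2 r f + nrm2 s f.
Proof.
rewrite -ler_sqr ?nnegrE ?addr_ge0 ?nrm2_ge0// sqrrD !sqr_nrm2 big_cat /=.
by rewrite lerD2r lerDl mulrn_wge0// mulr_ge0 ?nrm2_ge0.
Qed.

Lemma nrm2_conj {R : realType} {I : Type} (r : seq I) (f : I -> R[i]) :
  nrm2 r (fun i => cconj (f i)) = nrm2 r f.
Proof. by rewrite /nrm2; under eq_bigr do rewrite cabs_conj. Qed.

(** * Gram matrices and the Schur test *)

Lemma conj_gram {R : realType} {N : nat} (U : 'I_N -> nat -> R[i]) (i j : nat) :
  cconj (gram U i j) = gram U j i.
Proof.
rewrite conj_sum; apply: eq_bigr => n _.
by rewrite cconjM cconjK mulrC.
Qed.

Lemma cabs_gramC {R : realType} {N : nat} (U : 'I_N -> nat -> R[i]) (i j : nat) :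
  cabs (gram U i j) = cabs (gram U j i).
Proof. by rewrite -conj_gram cabs_conj. Qed.

Lemma sum_delta {R : realType} (r : seq nat) (u : nat -> R[i]) (i : nat) :
  uniq r -> i \in r -> \sum_(j <- r) (i == j)%:R * u j = u i.
Proof.
move=> ur ir; rewrite (bigD1_seq i)//= eqxx mul1r big1 ?addr0// => j.
by rewrite eq_sym => /negbTE ->; rewrite mul0r.
Qed.

(** Weak form of the factorisation G = U^*U; it lets G move from one side of a pairing to the
    other. *)
Lemma sum_gram {R : realType} {N : nat} (U : 'I_N -> nat -> R[i]) (r s : seq nat)
    (u v : nat -> R[i]) :
  \sum_(i <- r) cconj (u i) * (\sum_(j <- s) gram U i j * v j) =
  \sum_(n < N) cconj (\sum_(i <- r) U n i * u i) * \sum_(j <- s) U n j * v j.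
Proof.
under eq_bigr => i _.
  under eq_bigr do rewrite mulr_suml.
  rewrite exchange_big /= mulr_sumr; over.
rewrite exchange_big /=; apply: eq_bigr => n _.
rewrite conj_sum mulr_suml; apply: eq_bigr => i _.
rewrite !mulr_sumr; apply: eq_bigr => j _.
by rewrite cconjM; ring.
Qed.

(** Each term satisfies 2 |B_ij| |u_i| |u_j| <= |B_ij| (|u_i|^2 + |u_j|^2), and the symmetry of |B|
    makes both halves sum to the same [S], which row sums bound. *)
Lemma schur_quad {R : realType} (r : seq nat) (B : nat -> nat -> R[i]) (eps : R)
    (u : nat -> R[i]) :
  (forall i, i \in r -> \sum_(j <- r) cabs (B i j) <= eps) ->
  (forall i j, cabs (B i j) = cabs (B j i)) ->
  cabs (\sum_(i <- r) cconj (u i) * \sum_(j <- r) B i j * u j) <= eps * nrm2 r u ^+ 2.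
Proof.
move=> rowB symB.
pose S := \sum_(i <- r) \sum_(j <- r) cabs (B i j) * cabs (u i) ^+ 2.
have S_le : S <= eps * nrm2 r u ^+ 2.
  rewrite sqr_nrm2 mulr_sumr /S !big_seq ler_sum// => i ir.
  by rewrite -mulr_suml ler_wpM2r ?sqr_ge0 ?rowB.
have S_sym : S = \sum_(i <- r) \sum_(j <- r) cabs (B i j) * cabs (u j) ^+ 2.
  rewrite /S exchange_big; apply: eq_bigr => i _; apply: eq_bigr => j _.
  by rewrite symB.
apply: le_trans S_le; rewrite -(@ler_pM2l _ 2)//.
have -> : 2 * S = S + S by ring.
rewrite {2}S_sym -big_split /= (le_trans (ler_wpM2l _ (ler_cabs_sum _ _ _)))//.
rewrite mulr_sumr ler_sum// => i _; rewrite -big_split /= cabsM.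
rewrite (le_trans (ler_wpM2l _ (ler_wpM2l _ (ler_cabs_sum _ _ _)))) ?cabs_ge0//.
rewrite !mulr_sumr ler_sum// => j _; rewrite cabs_conj cabsM.
have := sqr_ge0 (cabs (u i) - cabs (u j)); have := cabs_ge0 (B i j).
move: (cabs _) (cabs (u i)) (cabs (u j)) => b p q b0 /(mulr_ge0 b0) h.
rewrite -subr_ge0 (le_trans h)// le_eqVlt; apply/orP; left; apply/eqP; ring.
Qed.

Lemma sum_gram_nrm2 {R : realType} {N : nat} (U : 'I_N -> nat -> R[i]) (r : seq nat)
    (u : nat -> R[i]) :
  \sum_(i <- r) cconj (u i) * (\sum_(j <- r) gram U i j * u j) =
  ((nrm2 (index_enum 'I_N) (fun n => \sum_(j <- r) U n j * u j)) ^+ 2)%:C%C.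
Proof.
rewrite sum_gram sqr_nrm2 rmorph_sum; apply: eq_bigr => n _.
by rewrite mul_conj.
Qed.

(** * Gram matrices close to the identity in the l^oo operator norm *)

Section GramNearIdentity.
Context {R : realType} {N : nat} (U : 'I_N -> nat -> R[i]) (r : seq nat) (eps : R).
Hypothesis uniq_r : uniq r.
Hypothesis row_le : forall i, i \in r ->
  \sum_(j <- r) cabs ((i == j)%:R - gram U i j) <= eps.

Local Notation synth u := (nrm2 (index_enum 'I_N) (fun n => \sum_(j <- r) U n j * u j)).

Lemma near_isometry (u : nat -> R[i]) :
  `|synth u ^+ 2 - nrm2 r u ^+ 2| <= eps * nrm2 r u ^+ 2.
Proof.
rewrite -cabs_real; apply: le_trans (schur_quad r _ eps u row_le _); last first.
  by move=> i j; rewrite -cabs_conj !cconjE rmorphB /= rmorph_nat -cconjE conj_gram eq_sym.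
(* The quadratic form of I - G is |u|^2 - |Uu|^2, hence the change of sign. *)
rewrite -cabsN le_eqVlt; apply/orP; left; apply/eqP; congr cabs.
under [RHS]eq_big_seq => i ir.
  under eq_bigr do rewrite mulrBl.
  rewrite sumrB sum_delta// mulrBr; over.
rewrite sumrB sum_gram_nrm2 rmorphB /= opprB; congr (_ - _).
rewrite sqr_nrm2 rmorph_sum; apply: eq_bigr => i _; by rewrite mul_conj.
Qed.

(** Weakening sqrt(1 + eps) to 1 + eps keeps all later constants rational in [eps]. *)
Lemma synth_le (u : nat -> R[i]) : 0 <= eps -> synth u <= (1 + eps) * nrm2 r u.
Proof.
move=> e0; rewrite -ler_sqr ?nnegrE ?mulr_ge0 ?nrm2_ge0 ?addr_ge0//.
have := near_isometry u; rewrite ler_norml => /andP[_].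
have := mulr_ge0 e0 (sqr_ge0 (nrm2 r u)).
have := mulr_ge0 e0 (mulr_ge0 e0 (sqr_ge0 (nrm2 r u))).
nra.
Qed.

(** Duality with [synth_le]: for b = U^*c, |b|^2 = <Ub, c> <= (1 + eps) |b| |c|, and one factor |b|
    cancels. *)
Lemma analysis_le (c : 'I_N -> R[i]) : 0 <= eps ->
  nrm2 r (fun j => \sum_(n < N) cconj (U n j) * c n) <= (1 + eps) * nrm2 (index_enum 'I_N) c.
Proof.
move=> e0; set b := fun j => _.
have h : nrm2 r b ^+ 2 <= ((1 + eps) * nrm2 (index_enum 'I_N) c) * nrm2 r b.
  have e1 : (nrm2 r b ^+ 2)%:C%C =
      \sum_(n < N) cconj (\sum_(j <- r) U n j * b j) * c n.
    rewrite sqr_nrm2 rmorph_sum /=; under eq_bigr do rewrite -mul_conj {2}/b mulr_sumr.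
    rewrite exchange_big; apply: eq_bigr => n _; rewrite conj_sum mulr_suml.
    by apply: eq_bigr => i _; rewrite !cconjE rmorphM /=; ring.
  rewrite -[leLHS]ger0_norm ?sqr_ge0// -cabs_real e1.
  rewrite (le_trans (cauchy_schwarz_cabs _ _ _))// nrm2_conj mulrAC ler_wpM2r ?nrm2_ge0//.
  exact: synth_le.
have := nrm2_ge0 r b; rewrite le_eqVlt => /predU1P[<-|b0].
  by rewrite mulr_ge0 ?nrm2_ge0// addr_ge0.
by move: h; rewrite expr2 ler_pM2r.
Qed.

(** Follows from (1 - eps) |u|^2 <= |Uu|^2 = <u, Gu> <= |u| |Gu|. *)
Lemma gram_inverse_le (u : nat -> R[i]) :
  (1 - eps) * nrm2 r u <= nrm2 r (fun i => \sum_(j <- r) gram U i j * u j).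
Proof.
have := nrm2_ge0 r u; rewrite le_eqVlt => /predU1P[<-|u0].
  by rewrite mulr0 nrm2_ge0.
rewrite -(ler_pM2r u0) -mulrA -expr2.
have := cauchy_schwarz_cabs r (fun i => cconj (u i)) (fun i => \sum_(j <- r) gram U i j * u j).
rewrite nrm2_conj sum_gram_nrm2 cabs_real ger0_norm ?sqr_ge0// mulrC; apply: le_trans.
have := near_isometry u; rewrite ler_norml => /andP[+ _]; lra.
Qed.

(** Writing g = Gg + (I - G)g, the largest modulus [a] of the entries of g satisfies a <= m + eps
    a. *)
Lemma gram_inverse_sup (g : nat -> R[i]) (m : R) : eps < 1 ->
  (forall i, i \in r -> cabs (\sum_(j <- r) gram U i j * g j) <= m) ->
  forall i, i \in r -> (1 - eps) * cabs (g i) <= m.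
Proof.
move=> e1 sm i0 ir0.
pose a := \big[Order.max/0]_(i <- r) cabs (g i).
have g_le i : i \in r -> cabs (g i) <= a.
  by move=> ir; exact: (@le_bigmax_seq _ _ _ r 0 i xpredT (fun j => cabs (g j)) ir isT).
have a0 : 0 <= a by exact: bigmax_ge_id.
have m0 : 0 <= m by apply: le_trans (sm _ ir0); exact: cabs_ge0.
have e0 : 0 <= eps.
  by apply: le_trans (row_le _ ir0); rewrite sumr_ge0// => i _; rewrite cabs_ge0.
suff am : a <= m + eps * a.
  have : (1 - eps) * cabs (g i0) <= (1 - eps) * a.
    by rewrite ler_wpM2l ?g_le// subr_ge0 ltW.
  by move=> h; apply: le_trans h _; lra.
rewrite {1}/a big_seq; apply: bigmax_le => [|i ir].
  by rewrite addr_ge0// mulr_ge0.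
have -> : g i = \sum_(j <- r) gram U i j * g j +
    \sum_(j <- r) ((i == j)%:R - gram U i j) * g j.
  by under [X in _ + X]eq_bigr do rewrite mulrBl; rewrite sumrB sum_delta// addrC subrK.
rewrite (le_trans (ler_cabsD _ _))// lerD ?sm//.
rewrite (le_trans (ler_cabs_sum _ _ _))//.
apply: le_trans (ler_wpM2r a0 (row_le _ ir)).
rewrite mulr_suml !big_seq ler_sum// => j jr.
by rewrite cabsM ler_wpM2l ?cabs_ge0 ?g_le.
Qed.

End GramNearIdentity.

(** A square matrix with trivial kernel is invertible, and [gram_inverse_sup] with bound 0 forces
    the kernel to vanish. *)
Lemma gram_solve {R : realType} {N : nat} (U : 'I_N -> nat -> R[i]) (M : nat) (eps : R)
    (s : nat -> R[i]) :
  eps < 1 ->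
  (forall i, (i < M)%N -> \sum_(0 <= j < M) cabs ((i == j)%:R - gram U i j) <= eps) ->
  exists g : nat -> R[i], forall i, (i < M)%N -> \sum_(0 <= j < M) gram U i j * g j = s i.
Proof.
move=> e1 row_le.
(* Transposed, because matrices act here on row vectors from the right. *)
pose G : 'M[R[i]]_M := \matrix_(i, j) gram U j i.
pose ext (u : 'rV[R[i]]_M) (k : nat) : R[i] := \sum_(j < M | j == k :> nat) u 0 j.
have extE u (i : 'I_M) : ext u i = u 0 i.
  by rewrite /ext (big_pred1 i).
have mulG u (i : 'I_M) : \sum_(0 <= j < M) gram U i j * ext u j = (u *m G) 0 i.
  rewrite big_mkord !mxE; apply: eq_bigr => j _.
  by rewrite extE mxE mulrC.
have Gunit : row_free G.
  rewrite -kermx_eq0; apply/eqP/row_matrixP => k; rewrite row0.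
  set u := row k _.
  have uG : u *m G = 0 by rewrite -row_mul mulmx_ker row0.
  apply/rowP => i; rewrite [RHS]mxE -extE.
  have := @gram_inverse_sup _ _ U (index_iota 0 M) eps (iota_uniq _ _) _ (ext u) 0 e1.
  move=> /(_ _ _ i) h; apply/eqP; rewrite -cabs_eq0 eq_le cabs_ge0 andbT.
  rewrite -(@pmulr_rle0 _ (1 - eps)) ?subr_gt0//; apply: h.
  - by move=> j; rewrite mem_index_iota => /row_le.
  - move=> j; rewrite mem_index_iota /= => jM.
    by rewrite (mulG u (Ordinal jM)) uG mxE cabs0.
  - by rewrite mem_index_iota /=.
pose sv : 'rV[R[i]]_M := \row_j s j.
exists (ext (sv *m invmx G)) => i iM.
rewrite (mulG _ (Ordinal iM)) mulmxKV ?mxE//.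
by rewrite -row_free_unit.
Qed.

(** * Complex signs, row sums and the cone condition *)

Definition csgn {R : realType} (z : R[i]) : R[i] := z * ((cabs z)^-1)%:C%C.

Lemma cabs_csgn_le1 {R : realType} (z : R[i]) : cabs (csgn z) <= 1.
Proof.
rewrite cabsM cabs_real ger0_norm ?invr_ge0 ?cabs_ge0//.
by have [->|z0] := eqVneq (cabs z) 0; rewrite ?mul0r// divff.
Qed.

Lemma conj_csgn_mul {R : realType} (z : R[i]) : cconj (csgn z) * z = (cabs z)%:C%C.
Proof.
rewrite /csgn cconjM cconj_real mulrAC mul_conj -rmorphM /=.
have [->|z0] := eqVneq (cabs z) 0; first by rewrite expr0n mul0r.
by rewrite expr2 mulfK.
Qed.

(** Tested on the conjugate signs of row [i], the operator returns the l^1 norm of that row as its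
    entry [i]. *)
Lemma opnorm_row_le {R : realType} (A : nat -> nat -> R[i]) (M : nat) (c : R) :
  (ereal_sup [set linfnorm (applyM M A v) | v in [set v | (linfnorm v <= 1)%E]] <= c%:E)%E ->
  forall i, \sum_(0 <= j < M) cabs (A i j) <= c.
Proof.
move=> Ac i; pose v j := cconj (csgn (A i j)).
have v1 : (linfnorm v <= 1)%E.
  by apply: ge_ereal_sup => _ [j _ <-]; rewrite lee_fin cabs_conj cabs_csgn_le1.
rewrite -lee_fin; apply: le_trans Ac; apply: (@le_trans _ _ (linfnorm (applyM M A v))); last first.
  by apply: ereal_sup_ubound; exists v.
apply: ereal_sup_ubound; exists i => //; congr EFin.
rewrite /applyM; under eq_bigr do rewrite mulrC conj_csgn_mul.
rewrite -[in LHS]rmorph_sum /= cabs_real ger0_norm ?sumr_ge0//.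
  by rewrite big_mkord.
by move=> j _; exact: cabs_ge0.
Qed.

(** On the head, [s] is a subgradient at [xb] of the weighted l^1 norm, so the head sum of [xh]
    falls below that of [xb] by at most the pairing. Minimality passes this loss to the tail, where
    the triangle inequality finishes. *)
Lemma minimizer_cone {R : realType} (w : nat -> R) (xb xh : nat -> R[i]) (M L : nat) :
  (M <= L)%N -> (forall i, 0 <= w i) ->
  \sum_(0 <= i < L) w i * cabs (xh i) <= \sum_(0 <= i < L) w i * cabs (xb i) ->
  exists2 s : nat -> R[i], forall i, cabs (s i) <= w i &
    \sum_(M <= i < L) w i * cabs (xh i - xb i) <=
      2 * \sum_(M <= i < L) w i * cabs (xb i) +
      cabs (\sum_(0 <= i < M) cconj (s i) * (xh i - xb i)).
Proof.
move=> ML w0; rewrite !(big_cat_nat (leq0n M) ML) /= => hmin.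
exists (fun i => (w i)%:C%C * csgn (xb i)) => [i|].
  by rewrite cabsM cabs_real ger0_norm// ler_piMr// cabs_csgn_le1.
have head : \sum_(0 <= i < M) w i * cabs (xb i) -
    cabs (\sum_(0 <= i < M) cconj ((w i)%:C%C * csgn (xb i)) * (xh i - xb i))
    <= \sum_(0 <= i < M) w i * cabs (xh i).
  rewrite -cabsN lerBlDr -lerBlDl (le_trans _ (ler_Re_cabs _))//.
  rewrite -[X in complex.Re X]sumrN Re_sum -sumrB ler_sum// => i _.
  (* Since conj(sgn z) z = |z|, each term compares |xb_i| with a number whose real part is at most
     |xh_i|. *)
  have -> : - (cconj ((w i)%:C%C * csgn (xb i)) * (xh i - xb i)) =
     (w i)%:C%C * ((cabs (xb i))%:C%C - cconj (csgn (xb i)) * xh i).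
    by rewrite -conj_csgn_mul cconjM cconj_real; ring.
  have : complex.Re (cconj (csgn (xb i)) * xh i) <= cabs (xh i).
    rewrite (le_trans (ler_Re_cabs _))// cabsM cabs_conj.
    by rewrite ler_piMl ?cabs_ge0 ?cabs_csgn_le1.
  case: (cconj _ * _) => a b /= ha.
  by rewrite mul0r subr0 -mulrBr ler_wpM2l// lerB.
have tail : \sum_(M <= i < L) w i * cabs (xh i - xb i) <=
    \sum_(M <= i < L) w i * cabs (xh i) + \sum_(M <= i < L) w i * cabs (xb i).
  rewrite -big_split /= ler_sum// => i _.
  by rewrite -mulrDr ler_wpM2l// (le_trans (ler_cabsD _ _))// cabsN.
by move: head tail hmin; lra.
Qed.

(** * Recovery estimates on the first [L] coordinates *)

Section StableRecovery.
Context {R : realType} {N : nat} (U : 'I_N -> nat -> R[i]) (M L : nat) (w : nat -> R)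
  (eps mw : R).
Hypothesis ML : (M <= L)%N.
Hypothesis eps_ge0 : 0 <= eps.
Hypothesis eps_lt1 : eps < 1.
Hypothesis w_ge0 : forall i, 0 <= w i.
Hypothesis mw_ge1 : 1 <= mw.
Hypothesis w_le_mw : forall i, (i < M)%N -> w i <= mw.
Hypothesis head_row : forall i, (i < M)%N ->
  \sum_(0 <= j < M) cabs ((i == j)%:R - gram U i j) <= eps.
Hypothesis tail_row : forall i, (M <= i < L)%N ->
  \sum_(0 <= j < M) cabs (gram U i j) <= eps / mw * w i.

Variable v : nat -> R[i].
Let head := index_iota 0 M.
Let p := \sum_(M <= i < L) w i * cabs (v i).
Let delta := nrm2 (index_enum 'I_N) (fun n => \sum_(0 <= j < L) U n j * v j).
(** [rr] is U^*U v and [b] the share of it due to the coordinates from [M] on, so [rr - b] is U^*U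
    P_M v. *)
Let rr j := \sum_(n < N) cconj (U n j) * \sum_(0 <= j < L) U n j * v j.
Let b j := \sum_(M <= i < L) gram U j i * v i.

Let uniq_head : uniq head. Proof. exact: iota_uniq. Qed.

Let head_row' i : i \in head ->
  \sum_(j <- head) cabs ((i == j)%:R - gram U i j) <= eps.
Proof. by rewrite mem_index_iota; exact: head_row. Qed.

Let gram_headE j : \sum_(i <- head) gram U j i * v i = rr j - b j.
Proof.
apply/eqP; rewrite eq_sym subr_eq -(big_cat_nat (leq0n M) ML) /=; apply/eqP.
rewrite /rr; under [LHS]eq_bigr do rewrite mulr_sumr.
rewrite exchange_big /=; apply: eq_bigr => i _; rewrite mulr_suml.
by apply: eq_bigr => n _; rewrite mulrA.
Qed.

Let rr_le : nrm2 head rr <= (1 + eps) * delta.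
Proof. exact: (analysis_le _ _ _ uniq_head head_row'). Qed.

(** Exchanging the sums leaves column sums of the Gram matrix; Hermitian symmetry turns them into
    the row sums of [tail_row], whose factor w_i produces [p]. *)
Let b_le : \sum_(j <- head) cabs (b j) <= eps / mw * p.
Proof.
apply: (@le_trans _ _ (\sum_(j <- head) \sum_(M <= i < L) cabs (gram U i j) * cabs (v i))).
  rewrite ler_sum// => j _; rewrite (le_trans (ler_cabs_sum _ _ _))// ler_sum// => i _.
  by rewrite cabsM cabs_gramC.
rewrite exchange_big /= /p mulr_sumr big_nat [leRHS]big_nat ler_sum// => i iML.
by rewrite -mulr_suml mulrA ler_wpM2r ?cabs_ge0 ?tail_row.
Qed.

Let p_ge0 : 0 <= p.
Proof. by rewrite sumr_ge0// => i _; rewrite mulr_ge0 ?cabs_ge0. Qed.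

(** Inverts G on [rr - b], with [b] measured in l^1, which dominates l^2; 1 <= mw then allows eps /
    mw <= eps. *)
Lemma head_recovery : (1 - eps) * nrm2 head v <= (1 + eps) * delta + eps * p.
Proof.
apply: le_trans (gram_inverse_le _ _ _ uniq_head head_row' v) _.
under [X in nrm2 _ X]eq_fun do rewrite gram_headE.
apply: le_trans (ler_nrm2D _ _ _) _; rewrite lerD//.
apply: le_trans (nrm2_le_sum _ _) _; under eq_bigr do rewrite cabsN.
apply: le_trans b_le _; rewrite ler_wpM2r// ler_pdivrMr ?(lt_le_trans ltr01)//.
by rewrite ler_peMr.
Qed.

(* Since [s = G g] and [G] is Hermitian, pairing [s] with [v] is pairing [g] with [G v]. *)
Lemma dual_pairing_le (s : nat -> R[i]) : (forall i, cabs (s i) <= w i) ->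
  (1 - eps) * cabs (\sum_(0 <= i < M) cconj (s i) * v i) <=
    (1 + eps) * Num.sqrt (\sum_(i < M) w i ^+ 2) * delta + eps * p.
Proof.
move=> s_le; have [g gE] := gram_solve U M eps s eps_lt1 head_row.
have mw_gt0 : 0 < mw by exact: lt_le_trans mw_ge1.
have -> : \sum_(0 <= i < M) cconj (s i) * v i =
    \sum_(j <- head) cconj (g j) * rr j + \sum_(j <- head) cconj (g j) * - b j.
  rewrite -big_split /=; under [RHS]eq_bigr do rewrite -mulrDr -gram_headE.
  (* Both sides are the inner product of U P_M v and U g over the nodes: [sum_gram] is used
     forwards, then backwards under a conjugation. *)
  rewrite sum_gram -[RHS]cconjK conj_sum.
  under [in RHS]eq_bigr => n _.
    rewrite (_ : cconj _ = cconj (\sum_(i <- head) U n i * v i) *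
      \sum_(j <- head) U n j * g j); last by rewrite cconjM cconjK mulrC.
    over.
  rewrite -sum_gram conj_sum; apply: eq_big_nat => i /andP[_ iM].
  by rewrite gE// cconjM cconjK mulrC.
have g_nrm : (1 - eps) * nrm2 head g <= Num.sqrt (\sum_(i < M) w i ^+ 2).
  apply: le_trans (gram_inverse_le _ _ _ uniq_head head_row' g) _.
  rewrite /nrm2 ler_wsqrtr// -(big_mkord xpredT (fun i => w i ^+ 2)).
  rewrite /head [leLHS]big_nat [leRHS]big_nat ler_sum// => i /andP[_ iM].
  by rewrite gE// ler_sqr ?nnegrE ?cabs_ge0.
have g_sup j : j \in head -> (1 - eps) * cabs (g j) <= mw.
  apply: (gram_inverse_sup _ _ _ uniq_head head_row') => // i; rewrite mem_index_iota.
  by move=> /= iM; rewrite gE// (le_trans (s_le i))// w_le_mw.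
have e1 : 0 <= 1 - eps by rewrite subr_ge0 ltW.
(* The [rr] term pairs l^2 with l^2, the [b] term pairs l^oo with l^1. *)
rewrite (le_trans (ler_wpM2l e1 (ler_cabsD _ _)))// mulrDr lerD//.
  apply: le_trans (ler_wpM2l e1 (cauchy_schwarz_cabs _ _ _)) _.
  rewrite nrm2_conj mulrA [leRHS]mulrAC [leRHS]mulrC.
  by rewrite ler_pM ?mulr_ge0 ?nrm2_ge0.
apply: le_trans (ler_wpM2l e1 (ler_cabs_sum _ _ _)) _.
rewrite mulr_sumr; apply: (@le_trans _ _ (\sum_(j <- head) mw * cabs (b j))).
  rewrite !big_seq ler_sum// => j jh.
  by rewrite cabsM cabs_conj cabsN mulrA ler_wpM2r ?cabs_ge0 ?g_sup.
rewrite -mulr_sumr (le_trans (ler_wpM2l (ltW mw_gt0) b_le))//.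
(* The factor [mw] from [g_sup] cancels the 1 / mw of [b_le]. *)
by rewrite mulrA mulrCA divff ?gt_eqF// mulr1.
Qed.

(** After multiplication by 1 - eps the pairing contributes eps p, which the left side absorbs; this
    is the source of 1 - 2 eps. *)
Lemma tail_recovery (s : nat -> R[i]) (q : R) : 0 <= q ->
  (forall i, cabs (s i) <= w i) ->
  p <= 2 * q + cabs (\sum_(0 <= i < M) cconj (s i) * v i) ->
  (1 - 2 * eps) * p <= 2 * q + (1 + eps) * Num.sqrt (\sum_(i < M) w i ^+ 2) * delta.
Proof.
move=> q0 /dual_pairing_le; set c := cabs _; set X := _ * _ * delta => hc hp.
have h : (1 - eps) * p <= (1 - eps) * (2 * q + c) by rewrite ler_wpM2l// subr_ge0 ltW.
by have := mulr_ge0 eps_ge0 q0; nra.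
Qed.

End StableRecovery.

(** * Passage between truncated and infinite sums *)

(** The limit depends on late truncations alone; the threshold [n0] allows cut-offs beyond both [K]
    and [M]. *)
Lemma l2norm_le {R : realType} (v : nat -> R[i]) (B : R) (n0 : nat) : 0 <= B ->
  (forall n, (n0 <= n)%N -> nrm2 (index_iota 0 n) v <= B) -> (l2norm v <= B%:E)%E.
Proof.
move=> B0 vB.
have : (\sum_(i <oo) (cabs (v i) ^+ 2)%:E <= (B ^+ 2)%:E)%E.
  apply: lime_le; first by apply: is_cvg_nneseries => i _ _; rewrite lee_fin sqr_ge0.
  near=> n; rewrite sumEFin lee_fin -sqr_nrm2 ler_sqr ?nnegrE ?nrm2_ge0// vB//.
  by near: n; exists n0.
rewrite /l2norm; case: (limn _) => [r||] //= rB.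
by rewrite lee_fin -(ger0_norm B0) -sqrtr_sqr ler_wsqrtr// -lee_fin.
Unshelve. all: by end_near. Qed.

Lemma wnorm1_supported {R : realType} (w : nat -> R) (v : nat -> R[i]) (K L : nat) :
  supported K v -> (K <= L)%N -> wnorm1 w v = (\sum_(0 <= i < L) w i * cabs (v i))%:E.
Proof.
move=> vK KL; apply: cvg_lim => //.
apply: (@cvg_near_cst _ _ _ _ eventually).
near=> n; rewrite sumEFin; congr EFin.
have Ln : (L <= n)%N by near: n; exists L.
rewrite (big_cat_nat (leq0n L) Ln) /= [X in _ + X]big1_seq ?addr0// => i.
rewrite mem_index_iota => /andP[_ /andP[Li _]].
by rewrite vK ?cabs0 ?mulr0// (leq_trans KL).
Unshelve. all: by end_near. Qed.

Lemma wnorm1_sum_le {R : realType} (w : nat -> R) (v : nat -> R[i]) (B : R) (m n : nat) :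
  (forall i, 0 <= w i) ->
  (\sum_(m <= i <oo) (w i * cabs (v i))%:E <= B%:E)%E ->
  \sum_(m <= i < n) w i * cabs (v i) <= B.
Proof.
move=> w0 vB; rewrite -lee_fin -sumEFin; apply: le_trans vB.
by apply: nneseries_lim_ge => i _ _; rewrite lee_fin mulr_ge0 ?cabs_ge0.
Qed.

(** Normalisation gives 1 = int |g|^2 nu <= (sup |g|)^2 int nu = (sup |g|)^2. Every weight is
    therefore at least 1. *)
Lemma supnorm_ge1 {R : realType} (d : nat) (D : set 'rV[R]_d)
    (lam : {measure set 'rV[R]_d -> \bar R}) (nu : 'rV[R]_d -> R) (g : 'rV[R]_d -> R[i]) :
  D !=set0 -> measurable D -> (forall t, D t -> 0 <= nu t) ->
  lam.-integrable D (EFin \o nu) -> (\int[lam]_(t in D) (nu t)%:E = 1)%E ->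
  in_L2nu lam D nu g -> in_Linf D g ->
  (\int[lam]_(t in D) (complex.Re (g t * cconj (g t)) * nu t)%:E = 1)%E ->
  1 <= supnorm D g.
Proof.
move=> [t0 Dt0] mD nu0 inu nu1 [mRe [mIm _]] [B gB] g1.
have mnu : measurable_fun D nu by apply/measurable_EFinP; exact: measurable_int inu.
(* [sup] is an upper bound only for a nonempty bounded set; otherwise it takes a default value. *)
have hs : has_sup [set cabs (g t) | t in closure D].
  split; first by exists (cabs (g t0)), t0 => //; exact: subset_closure.
  by exists B => _ [t Dt <-]; exact: gB.
have g_le t : D t -> cabs (g t) <= supnorm D g.
  by move=> Dt; apply: sup_upper_bound => //; exists t => //; exact: subset_closure.
have S0 : 0 <= supnorm D g by apply: le_trans (g_le _ Dt0); exact: cabs_ge0.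
have ReE t : complex.Re (g t * cconj (g t)) = complex.Re (g t) ^+ 2 + complex.Im (g t) ^+ 2.
  by case: (g t) => a b /=; ring.
have Re_le t : D t -> complex.Re (g t * cconj (g t)) <= supnorm D g ^+ 2.
  move=> Dt; rewrite mulrC mul_conj /= ler_sqr ?nnegrE ?cabs_ge0//; exact: g_le.
have : (1 <= (supnorm D g ^+ 2)%:E)%E.
  rewrite -g1 -[leRHS]mule1 -nu1 -ge0_integralZl//; last first.
  - by rewrite lee_fin sqr_ge0.
  - exact/measurable_EFinP.
  apply: ge0_le_integral => //.
  - by move=> t Dt; rewrite lee_fin mulr_ge0 ?nu0// ReE addr_ge0 ?sqr_ge0.
  - apply/measurable_EFinP/measurable_funM => //.
    under eq_fun do rewrite ReE.
    by apply: measurable_funD; apply: measurable_funX.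
  - under eq_fun do rewrite -EFinM.
    by apply/measurable_EFinP/measurable_funM.
  - by move=> t Dt; rewrite -EFinM lee_fin ler_wpM2r ?nu0 ?Re_le.
by rewrite lee_fin -[leLHS](expr1n _ 2) ler_sqr ?nnegrE.
Qed.

(** * The constant and the assembly of the bounds *)

(** 1 - eps is lost in inverting G and 1 - 2 eps in absorbing the tail; the numerator dominates the
    coefficients of all the terms at once. *)
Definition recovery_const {R : realType} (eps : R) : R :=
  4 * (1 + eps) / ((1 - eps) * (1 - 2 * eps)).

Lemma recovery_const_cvg {R : realType} : @recovery_const R eps @[eps --> 0^'+] --> (4 : R).
Proof.
apply: cvg_at_right_filter.
have -> : (4 : R) = 4 * (1 + 0) / ((1 - 0) * (1 - 2 * 0)) by field.
apply: cvgM; first by apply: cvgMr; apply: cvgD; [exact: cvg_cst|exact: cvg_id].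
apply: cvgV; first by rewrite mulr0 subr0 mulr1 oner_eq0.
apply: cvgM; first by apply: cvgB; [exact: cvg_cst|exact: cvg_id].
by apply: cvgB; [exact: cvg_cst|apply: cvgMr; exact: cvg_id].
Qed.

Lemma recovery_const_gt0 {R : realType} (eps : R) : 0 < eps < 1 / 2 -> 0 < recovery_const eps.
Proof.
move=> /andP[e0 e1]; rewrite divr_gt0 ?mulr_gt0//; lra.
Qed.

(** Splits x - xh into x - xb and -v, and v into head and tail. The bound by [B] is asked at every
    [m] to serve the cuts 0, [M] and [L]. *)
Lemma recovery_partial {R : realType} {N : nat} (U : 'I_N -> nat -> R[i]) (M K L : nat)
    (w : nat -> R) (eps mw eta a B : R) (y : 'I_N -> R[i]) (x xb xh : nat -> R[i]) :
  (M <= L)%N -> (K <= L)%N -> 0 < eps < 1 / 2 -> (forall i, 1 <= w i) -> 1 <= mw ->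
  (forall i, (i < M)%N -> w i <= mw) ->
  (forall i, (i < M)%N ->
     \sum_(0 <= j < M) cabs ((i == j)%:R - gram U i j) <= eps) ->
  (forall i, (M <= i < L)%N ->
     \sum_(0 <= j < M) cabs (gram U i j) <= eps / mw * w i) ->
  feasible U K y eta xb -> feasible U K y eta xh ->
  (wnorm1 w xh <= wnorm1 w xb)%E ->
  \sum_(M <= i < L) w i * cabs (x i) <= a ->
  (forall m, \sum_(m <= i < L) w i * cabs (x i - xb i) <= B) ->
  nrm2 (index_iota 0 L) (fun i => x i - xh i) <=
    recovery_const eps * ((1 + Num.sqrt (\sum_(i < M) w i ^+ 2)) * eta + a + B).
Proof.
move=> ML KL /andP[e0 e1] w1 mw1 wmw head tail [xbK xbr] [xhK xhr] hmin xa xbB.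
have w0 i : 0 <= w i by apply: le_trans (w1 i).
rewrite (wnorm1_supported _ _ _ _ xhK KL) (wnorm1_supported _ _ _ _ xbK KL) lee_fin in hmin.
have [s sw hs] := minimizer_cone _ _ _ _ _ ML w0 hmin.
pose v i := xh i - xb i.
pose delta := nrm2 (index_enum 'I_N) (fun n => \sum_(0 <= j < L) U n j * v j).
pose p := \sum_(M <= i < L) w i * cabs (v i).
pose q := \sum_(M <= i < L) w i * cabs (xb i).
have q0 : 0 <= q by rewrite sumr_ge0// => i _; rewrite mulr_ge0 ?cabs_ge0.
have eps0 := ltW e0.
have eps1 : eps < 1 by lra.
have p_le := tail_recovery U M L w eps mw ML eps0 eps1 w0 mw1 wmw head tail v s q q0 sw hs.
have h_le := head_recovery U M L w eps mw ML eps0 w0 mw1 head tail v.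
rewrite -/delta -/p in p_le h_le.
have sumK (u : nat -> R[i]) n : supported K u ->
    \sum_(i < K) U n i * u i = \sum_(0 <= i < L) U n i * u i.
  move=> uK; rewrite (big_cat_nat (leq0n K) KL) /= [X in _ + X]big1_seq ?addr0 ?big_mkord//.
  by move=> i; rewrite mem_index_iota => /andP[_ /andP[Ki _]]; rewrite uK// mulr0.
(* The data [y] cancel in the difference of two residuals, each at most [eta]. *)
have delta_le : delta <= 2 * eta.
  have -> : delta = nrm2 (index_enum 'I_N) (fun n => (\sum_(i < K) U n i * xh i - y n) +
      - (\sum_(i < K) U n i * xb i - y n)).
    congr nrm2; apply/funext => n; rewrite !sumK// /v.
    by under eq_bigr do rewrite mulrBr; rewrite sumrB; ring.
  apply: le_trans (ler_nrm2D _ _ _) _; rewrite mulr_natl mulr2n lerD//.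
  by rewrite /nrm2; under eq_bigr do rewrite cabsN.
have q_le : q <= a + B.
  apply: le_trans (lerD xa (xbB M)); rewrite -big_split /= ler_sum// => i _.
  rewrite -mulrDr ler_wpM2l//.
  have {1}-> : xb i = x i + - (x i - xb i) by ring.
  by rewrite (le_trans (ler_cabsD _ _))// cabsN.
have x_le : nrm2 (index_iota 0 L) (fun i => x i - xh i) <=
    B + (nrm2 (index_iota 0 M) v + p).
  have -> : (fun i => x i - xh i) = (fun i => (x i - xb i) + - v i).
    by apply/funext => i; rewrite /v; ring.
  apply: le_trans (ler_nrm2D _ _ _) _; rewrite lerD//.
    apply: le_trans (nrm2_le_sum _ _) _; apply: le_trans (xbB 0%N).
    by rewrite ler_sum// => i _; rewrite ler_peMl ?cabs_ge0.
  have -> : nrm2 (index_iota 0 L) (fun i => - v i) = nrm2 (index_iota 0 L) v.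
    by rewrite /nrm2; under eq_bigr do rewrite cabsN.
  have -> : index_iota 0 L = index_iota 0 M ++ index_iota M L.
    by rewrite /index_iota !subn0 -{1}(subnKC ML) iotaD.
  apply: le_trans (nrm2_cat _ _ _) _; rewrite lerD2l.
  apply: le_trans (nrm2_le_sum _ _) _.
  by rewrite ler_sum// => i _; rewrite ler_peMl ?cabs_ge0.
have delta0 : 0 <= delta by exact: nrm2_ge0.
have eta0 : 0 <= eta by lra.
have B0 : 0 <= B.
  (* At [m = L] the sum is empty. *)
  by apply: le_trans (xbB L); rewrite big_geq.
have a0 : 0 <= a.
  by apply: le_trans xa; rewrite sumr_ge0// => i _; rewrite mulr_ge0 ?cabs_ge0.
move: p_le h_le x_le; set om := Num.sqrt _ => p_le h_le x_le.
have om0 : 0 <= om by exact: sqrtr_ge0.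
apply: le_trans x_le _.
rewrite /recovery_const mulrAC ler_pdivlMr; last by rewrite mulr_gt0//; lra.
have om_d : om * delta <= om * (2 * eta) by rewrite ler_wpM2l.
move: (nrm2 _ v) h_le => hv h_le.
have h1 : (1 - 2 * eps) * ((1 - eps) * hv) <=
    (1 - 2 * eps) * ((1 + eps) * (2 * eta) + eps * p).
  rewrite ler_wpM2l; [by []|lra|].
  apply: le_trans h_le _; rewrite lerD2r ler_wpM2l//; lra.
have h2 : (1 - 2 * eps) * p <= 2 * (a + B) + (1 + eps) * (om * (2 * eta)).
  apply: le_trans p_le _; rewrite lerD ?ler_wpM2l//.
  by rewrite -mulrA ler_wpM2l//; lra.
(* The goal is linear once products such as [om * eta] and [eps * B] count as unknowns; these facts
   supply their signs. *)
have oe0 := mulr_ge0 om0 eta0.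
have h3 : (1 - eps) * (1 - 2 * eps) * B <= B.
  by rewrite ler_piMl// mulr_ile1//; lra.
have h4 := mulr_ge0 eps0 eta0.
have h5 := mulr_ge0 eps0 B0.
have h6 := mulr_ge0 eps0 a0.
have h7 := mulr_ge0 eps0 oe0.
have h8 := mulr_ge0 eps0 h4.
lra.
Qed.

Lemma Einf_row_le {R : realType} {N : nat} (U : 'I_N -> nat -> R[i]) (M : nat) (c : R) :
  (Eerr U M < c%:E)%E -> forall i, (i < M)%N ->
  \sum_(0 <= j < M) cabs ((i == j)%:R - gram U i j) <= c.
Proof.
rewrite /Eerr gt_max => /andP[_ /ltW Ec] i iM.
by have := opnorm_row_le _ _ _ Ec i; rewrite /IminusG iM.
Qed.

(** For M <= i < Rr the row lies off the diagonal block of size M, so I - G agrees there with -G and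
    the bound on [Eerr] applies. *)
Lemma gram_tail_row {R : realType} {N : nat} (U : 'I_N -> nat -> R[i]) (w : nat -> R)
    (M Rr : nat) (eps mw minw : R) :
  (forall i, 1 <= w i) -> (M <= Rr)%N -> 0 <= eps / mw ->
  (forall i, (M <= i < Rr)%N -> minw <= w i) ->
  (Eerr U Rr < (eps * minw / mw)%:E)%E -> (Ferr U w M Rr <= (eps / mw)%:E)%E ->
  forall i, (M <= i)%N -> \sum_(0 <= j < M) cabs (gram U i j) <= eps / mw * w i.
Proof.
move=> w1 MR em0 minw_le ER FR i Mi; have wi0 : 0 < w i by exact: lt_le_trans (w1 i).
have [iR|Ri] := ltnP i Rr.
  apply: (@le_trans _ _ (eps / mw * minw)); last by rewrite ler_wpM2l// minw_le// Mi.
  rewrite mulrAC; apply: le_trans (Einf_row_le _ _ _ ER i iR).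
  rewrite [leRHS](big_cat_nat (leq0n M) MR) /= ler_wpDr//.
    by rewrite sumr_ge0// => j _; rewrite cabs_ge0.
  rewrite big_nat [leRHS]big_nat ler_sum// => j /andP[_ jM].
  by rewrite gtn_eqF ?(leq_trans jM)// sub0r cabsN.
(* From [Rr] on, the matrix in [Ferr] carries the factor 1 / w_i, which is moved to the right
   side. *)
have := opnorm_row_le _ _ _ FR i; rewrite Ri => h.
rewrite -ler_pdivrMr// mulrC mulr_sumr; apply: le_trans h.
by rewrite ler_sum// => j _; rewrite cabsM cabs_real ger0_norm// invr_ge0 ltW.
Qed.

Theorem theorem5p6 (R : realType) :
  exists Cst : R -> R,
    Cst eps @[eps --> (0 : R)^'+] --> (4 : R) /\
    forall (d : nat) (D : set 'rV[R]_d) (lam : {measure set 'rV[R]_d -> \bar R})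
      (nu : 'rV[R]_d -> R) (phi : nat -> 'rV[R]_d -> R[i]) (z : nat -> R)
      (N : nat) (tp : 'I_N -> 'rV[R]_d) (eps : R) (M Rr K : nat)
      (x : nat -> R[i]) (e : 'I_N -> R[i]) (eta : R) (xh : nat -> R[i]),
    (* setting *)
    (0 < d)%N -> is_domain D -> is_lebesgue lam -> measurable D ->
    (forall t, D t -> 0 <= nu t) -> lam.-integrable D (EFin \o nu) ->
    (\int[lam]_(t in D) (nu t)%:E = 1)%E ->
    (forall i, in_L2nu lam D nu (phi i)) -> (forall i, in_Linf D (phi i)) ->
    orthonormal_nu lam D nu phi ->
    (forall n, closure D (tp n)) ->
    (* weights w_i = z_i ||phi_i||_oo, z_i >= 1, z_i -> oo *)
    (forall i, 1 <= z i) -> z @ \oo --> +oo ->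
    let w := fun i => z i * supnorm D (phi i) in
    let tau := qweight lam D nu tp in
    let U := Umat tau phi tp in
    let maxw := \big[Order.max/0]_(i < M) w i in
    let minw := \big[Order.min/w M]_(M <= i < Rr) w i in
    (* hypotheses of the theorem *)
    0 < eps < 1 / 2 ->
    (0 < density D tp)%E ->
    (0 < M)%N -> (M < Rr)%N ->
    (Eerr U M < eps%:E)%E ->
    (Eerr U Rr < (eps * minw / maxw)%:E)%E ->
    (Ferr U w M Rr <= (eps / maxw)%:E)%E ->
    (* target, noise, data, minimizer *)
    (wnorm1 w x < +oo)%E ->
    (forall n, cabs (e n) <= eta) ->
    let y := datay tau phi tp x e in
    is_minimizer w U K y eta xh ->
    (l2norm (fun i => (x i - xh i)%R) <=
       (Cst eps)%:E * (((1 + Num.sqrt (\sum_(i < M) w i ^+ 2)) * eta)%R%:E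
                      + tail_wnorm1 M w x + Tbest w U K y eta x))%E.
Proof.
exists recovery_const; split; first exact: recovery_const_cvg.
move=> d D lam nu phi z N tp eps M Rr K x e eta xh _ [_ [_ D0]] _ mD nu0 inu nu1 phi2.
move=> phioo phion _ z1 _ w tau U maxw minw eps01 _ M0 MR EM ER FR _ _ y [xhf hmin].
have C0 := recovery_const_gt0 eps eps01.
have w1 i : 1 <= w i.
  apply: mulr_ege1 => //; apply: (supnorm_ge1 _ _ lam nu) => //.
  by have [+ _] := phion i i; rewrite eqxx.
have w0 i : 0 <= w i by apply: le_trans (w1 i).
have wmw i : (i < M)%N -> w i <= maxw.
  by move=> iM; exact: (le_bigmax _ (fun j : 'I_M => w j) (Ordinal iM)).
have mw1 : 1 <= maxw by apply: le_trans (w1 _) (wmw _ M0).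
have minw_le i : (M <= i < Rr)%N -> minw <= w i.
  by move=> iMR; apply: (@bigmin_inf_seq _ _ _ _ _ i) => //; rewrite mem_index_iota.
have em0 : 0 <= eps / maxw by rewrite divr_ge0 ?(le_trans _ mw1)//; lra.
have tail_row := gram_tail_row U w M Rr eps maxw minw w1 (ltnW MR) em0 minw_le ER FR.
have head_row := Einf_row_le U M eps EM.
set om := Num.sqrt _.
have T0 : (0 <= Tbest w U K y eta x)%E.
  apply: le_ereal_inf_tmp => _ [xb _ <-].
  by apply: nneseries_ge0 => i _ _; rewrite lee_fin mulr_ge0 ?cabs_ge0.
have a0 : (0 <= tail_wnorm1 M w x)%E.
  by apply: nneseries_ge0 => i _ _; rewrite lee_fin mulr_ge0 ?cabs_ge0.
have eta0 : 0 <= eta by apply: le_trans xhf.2; exact: sqrtr_ge0.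
have om0 : 0 <= om by exact: sqrtr_ge0.
have oe0 : 0 <= (1 + om) * eta by rewrite mulr_ge0// addr_ge0.
(* If a term on the right is +oo the bound is trivial, since the constant is positive. *)
case Ea : (tail_wnorm1 M w x) a0 => [a||] // a0; last first.
  rewrite addey// addye ?gt0_muley ?leey//; by move: T0; case: Tbest.
case ET : (Tbest w U K y eta x) T0 => [T||] // T0; last first.
  by rewrite addey ?gt0_muley ?leey.
rewrite -!EFinD -EFinM.
have B0 : 0 <= recovery_const eps * ((1 + om) * eta + a + T).
  by rewrite mulr_ge0 ?(ltW C0)// !addr_ge0.
apply: (l2norm_le _ _ (K + M) B0) => L KML.
(* The infimum [Tbest] need not be attained: [xb] is chosen within r divided by the constant, so the
   final loss is exactly [r]. *)
apply/ler_addgt0Pr => r r0.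
have rC : 0 < r / recovery_const eps by rewrite divr_gt0.
have [|_ [xb xbf <-]] := @lb_ereal_inf_adherent _
  [set wnorm1 w (fun i => x i - xb i) | xb in feasible U K y eta] _ rC.
  by rewrite -/(Tbest w U K y eta x) ET.
rewrite -/(Tbest w U K y eta x) ET -EFinD => /ltW xb_le.
have -> : recovery_const eps * ((1 + om) * eta + a + T) + r =
    recovery_const eps * ((1 + om) * eta + a + (T + r / recovery_const eps)).
  by rewrite addrA [RHS]mulrDr mulrCA divff ?gt_eqF// mulr1.
apply: (recovery_partial U M K L w eps maxw eta a _ y x xb) => //.
- exact: leq_trans (leq_addl _ _) KML.
- exact: leq_trans (leq_addr _ _) KML.
- by move=> i /andP[Mi _]; exact: tail_row.
- exact: hmin.
- by apply: wnorm1_sum_le => //; rewrite -Ea.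
- move=> m; apply: le_trans (wnorm1_sum_le _ _ _ 0 L w0 xb_le).
  have [mL|Lm] := leqP m L.
    rewrite [leRHS](big_cat_nat (leq0n m) mL) /= ler_wpDl// sumr_ge0// => i _.
    by rewrite mulr_ge0 ?cabs_ge0.
  by rewrite big_geq ?(ltnW Lm)// sumr_ge0// => i _; rewrite mulr_ge0 ?cabs_ge0.
Qed.
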